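(* Let $K$ be an infinite field of characteristic different from $2$ and $3$, let $(A,\omega)$ be an arbitrary Bernstein algebra over $K$, and let $x\in A$ with $\omega(x)=1$. Consider the Bernstein subalgebra $\mathrm{alg}(x)$ generated by $x$. (i) The idempotent $e=x^2$ induces a Peirce decomposition $\mathrm{alg}(x)=Ke\oplus U_x\oplus V_x$, where $U_x=\langle x^3-x^2,\,x^4-x^2,\dots\rangle$, $U_x^2=0$, and $V_x=\langle v_1\rangle$ with $v_1=x+x^2-2x^3$. (ii) If $x$ is algebraic of degree $n\ge 4$, then there are a finite basis $(u_1,\dots,u_{n-2})$ of $U_x$ and scalars $\beta_1,\dots,\beta_{n-2}\in K$ such that $u_1=x^3-x^2$ and $$v_1u_i=u_{i+1}\ (1\le i\le n-3),\qquad v_1u_{n-2}=\beta_1u_1+\cdots+\beta_{n-2}u_{n-2},\qquad v_1^2=-2u_1-4u_2.$$ In this case, $\mathrm{alg}(x)$ is a train algebra if and only if $\beta_1=\cdots=\beta_{n-2}=0$. (iii) If $x$ is not algebraic, then there is a denumerable basis $(u_1,u_2,\dots)$ of $U_x$ such that $$u_1=x^3-x^2,\qquad v_1u_i=u_{i+1}\ (i\ge1),\qquad v_1^2=-2u_1-4u_2.$$ In this case, the algebra $\mathrm{alg}(x)$ is Noetherian but not Artinian.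
   Context: Algebras are not assumed associative, unital or finite-dimensional. A Bernstein algebra over $K$ is a commutative $K$-algebra $A$ with a nonzero algebra homomorphism $\omega:A\to K$ satisfying $(x^2)^2=\omega(x)^2x^2$ for all $x$. For an idempotent $e$ of weight $1$, the Peirce decomposition of a Bernstein algebra $B$ is $B=Ke\oplus U\oplus V$ with $U=\{u\in B:2eu=u\}$, $V=\{v\in B:ev=0\}$. $\langle X\rangle$ is the linear span of $X$; $\mathrm{alg}(x)$ is the subalgebra generated by $x$. Principal powers: $x^1=x$, $x^{k+1}=x^kx$. $x$ is algebraic if $\mathrm{alg}(x)$ is finite-dimensional, and then its degree is $\dim\mathrm{alg}(x)$. A commutative algebra with weight function $\omega$ is a train algebra if there are $r\ge2$ and $\gamma_1,\dots,\gamma_{r-1}\in K$ with $y^r+\gamma_1\omega(y)y^{r-1}+\cdots+\gamma_{r-1}\omega(y)^{r-1}y=0$ for all its elements $y$. Noetherian (Artinian) means the ascending (descending) chain condition on ideals of the algebra. *)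

(* Defs.v *)
From mathcomp Require Import all_boot all_algebra.
From mathcomp Require Import boolp classical_sets functions cardinality.

Set Implicit Arguments.
Unset Strict Implicit.
Unset Printing Implicit Defensive.

Import GRing.Theory.

Local Open Scope classical_set_scope.
Local Open Scope ring_scope.

Section LinearAlgebra.
Variables (K : fieldType) (A : lmodType K).
Implicit Types W X : set A.

Definition subspace W : Prop := submod_closed (mem W).

Definition lspan X : set A := smallest subspace X.

Definition lin_indep (I : eqType) (b : I -> A) : Prop :=
  forall (s : seq I) (c : I -> K), uniq s ->
    \sum_(i <- s) c i *: b i = 0 -> forall i, i \in s -> c i = 0.

Definition basis W (I : eqType) (b : I -> A) : Prop :=
  lin_indep b /\ lspan (range b) = W.

Definition has_dim W (n : nat) : Prop := exists b : 'I_n -> A, basis W b.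

Definition direct_sum3 W W1 W2 W3 : Prop :=
  W = [set w | exists w1 w2 w3, [/\ W1 w1, W2 w2, W3 w3 & w = w1 + w2 + w3]]
  /\ (forall w1 w2 w3, W1 w1 -> W2 w2 -> W3 w3 ->
        w1 + w2 + w3 = 0 -> [/\ w1 = 0, w2 = 0 & w3 = 0]).

End LinearAlgebra.

(* An algebra that need be neither associative, unital nor finite-dimensional
   is a K-module A with a bilinear product mul. The notions below are relative
   to a subset B of A, meant to be a subalgebra; B = setT gives A itself. *)
Section Algebras.
Variables (K : fieldType) (A : lmodType K).
Variables (mul : {bilinear A -> A -> A}) (omega : {scalar A}).
Implicit Types (B I U V : set A) (x y e : A).

Definition subalgebra B : Prop :=
  subspace B /\ (forall y z, B y -> B z -> B (mul y z)).

Definition alg x : set A := smallest subalgebra [set x].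

Definition algebraic x : Prop := exists n, has_dim (alg x) n.

Definition algebraic_of_degree x (n : nat) : Prop := has_dim (alg x) n.

(* x^1 = x and x^(k+1) = x^k x; the value x at k = 0 is a dummy. *)
Definition ppow x (k : nat) : A := iter k.-1 (fun y => mul y x) x.

Definition weighted_algebra B : Prop :=
  [/\ subalgebra B,
      forall y z, B y -> B z -> mul y z = mul z y,
      forall y z, B y -> B z -> omega (mul y z) = omega y * omega z
    & exists2 y, B y & omega y != 0].

Definition bernstein_algebra B : Prop :=
  weighted_algebra B /\
  (forall y, B y -> mul (mul y y) (mul y y) = omega y ^+ 2 *: mul y y).

Definition train_algebra B : Prop :=
  weighted_algebra B /\
  exists (r : nat) (gamma : nat -> K), (2 <= r)%N /\
    forall y, B y ->
      ppow y r + \sum_(1 <= i < r) (gamma i * omega y ^+ i) *: ppow y (r - i)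
      = 0.

Definition peirceU B e : set A := [set u | B u /\ 2%:R *: mul e u = u].

Definition peirceV B e : set A := [set v | B v /\ mul e v = 0].

Definition peirce_decomposition B e U V : Prop :=
  [/\ B e, mul e e = e, omega e = 1,
      U = peirceU B e /\ V = peirceV B e
    & direct_sum3 B (lspan [set e]) U V].

Definition ideal B I : Prop :=
  [/\ subspace I, I `<=` B & forall b y, B b -> I y -> I (mul b y)].

Definition noetherian B : Prop :=
  forall I : nat -> set A, (forall k, ideal B (I k)) ->
    (forall k, I k `<=` I k.+1) ->
    exists N, forall k, (N <= k)%N -> I k = I N.

Definition artinian B : Prop :=
  forall I : nat -> set A, (forall k, ideal B (I k)) ->
    (forall k, I k.+1 `<=` I k) ->
    exists N, forall k, (N <= k)%N -> I k = I N.

End Algebras.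

(* Main.v *)
(** Evaluating the Bernstein identity at e + t n for t = 1, -1, 2, -2 gives the
    Peirce identities, which is where characteristics 2 and 3 are excluded.
    Expanding x^2 = e along x = e + 2 u_1 + v_1 gives u_1^2 = 0 and the formula
    for v_1^2.  With w_i = v_1 (v_1 (... u_1)), the identity (u v)^2 = 0 (valid
    when u^2 = 0) gives w_i^2 = 0, and polarising u (u v) = 0 gives
    w_i w_(j+1) = - w_(i+1) w_j, hence w_i w_j = 0 for all i, j.  So U_x is the
    cyclic K[X]-module K[X] u_1, with X acting as multiplication by v_1, and
    alg(x) = Ke + K v_1 + K[X] u_1.  Let (g) be the annihilator of u_1.  If g is
    nonzero, alg(x) has dimension deg g + 2, the beta_i are minus the lower
    coefficients of g, and alg(x) is train iff g = X^m, since y^(k+2) is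
    X^k . y^2 for y = v_1 + u, and (R_y - omega(y)/2)^m kills U_x when X^m does.
    Ideals of alg(x) are sums of their Peirce components, so the ascending chain
    condition is that of K[X]; when g = 0 the ideals X^k K[X] u_1 strictly
    decrease. *)
Require Import Defs.
From HB Require Import structures.
From mathcomp Require Import all_boot all_algebra.
From mathcomp Require Import boolp classical_sets functions cardinality.
From mathcomp Require Import ring.
Import GRing.Theory.

Set Implicit Arguments.
Unset Strict Implicit.
Unset Printing Implicit Defensive.

Local Open Scope classical_set_scope.
Local Open Scope ring_scope.

(** * Linear combinations by reflection *)

Section ModuleReflection.
Variables (K : fieldType) (V : lmodType K).

Inductive mexpr : Type :=
  | MVar of nat
  | MZero
  | MAdd of mexpr & mexpr
  | MOpp of mexpr
  | MScale of K & mexpr.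

Fixpoint meval (env : seq V) (t : mexpr) : V :=
  match t with
  | MVar i => nth 0 env i
  | MZero => 0
  | MAdd t1 t2 => meval env t1 + meval env t2
  | MOpp t1 => - meval env t1
  | MScale c t1 => c *: meval env t1
  end.

Fixpoint mcoef (t : mexpr) (j : nat) : K :=
  match t with
  | MVar i => if eqn i j then 1 else 0
  | MZero => 0
  | MAdd t1 t2 => mcoef t1 j + mcoef t2 j
  | MOpp t1 => - mcoef t1 j
  | MScale c t1 => c * mcoef t1 j
  end.

Fixpoint mvars_lt (n : nat) (t : mexpr) : bool :=
  match t with
  | MVar i => (i < n)%N
  | MZero => true
  | MAdd t1 t2 => mvars_lt n t1 && mvars_lt n t2
  | MOpp t1 => mvars_lt n t1
  | MScale c t1 => mvars_lt n t1
  end.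

Fixpoint mcoef_eq (n : nat) (t1 t2 : mexpr) : Prop :=
  if n is n'.+1 then mcoef t1 n' = mcoef t2 n' /\ mcoef_eq n' t1 t2 else True.

Lemma mevalE (env : seq V) (t : mexpr) : mvars_lt (size env) t ->
  meval env t = \sum_(i < size env) mcoef t i *: nth 0 env i.
Proof.
elim: t => [j|_|t1 IH1 t2 IH2|t1 IH1|c t1 IH1] /=.
- move=> ltj; rewrite (bigD1 (Ordinal ltj)) //= -[eqn j j]/(j == j) eqxx scale1r.
  rewrite big1 ?addr0 // => i; rewrite -val_eqE /= eq_sym => neq_ji.
  by rewrite -[eqn j i]/(j == i) (negPf neq_ji) scale0r.
- by rewrite big1 // => i _; rewrite scale0r.
- move=> /andP[/IH1 -> /IH2 ->].
  by rewrite -big_split; apply: eq_bigr => i _; rewrite scalerDl.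
- by move=> /IH1 ->; rewrite -sumrN; apply: eq_bigr => i _; rewrite scaleNr.
- by move=> /IH1 ->; rewrite scaler_sumr; apply: eq_bigr => i _; rewrite scalerA.
Qed.

(** Equal coefficients suffice, even when the vectors in [env] are linearly dependent. *)
Lemma mevalP (env : seq V) (t1 t2 : mexpr) :
  mvars_lt (size env) t1 && mvars_lt (size env) t2 ->
  mcoef_eq (size env) t1 t2 -> meval env t1 = meval env t2.
Proof.
move=> /andP[v1 v2] eqc; rewrite !mevalE //; apply: eq_bigr => i _.
congr (_ *: _); move: (nat_of_ord i) (ltn_ord i) eqc => {i}.
elim: (size env) => [//|n IHn] i /=; rewrite ltnS leq_eqVlt.
by case/predU1P=> [-> []//|lti [_ /IHn]]; apply.
Qed.

End ModuleReflection.

Ltac madd_atom l a :=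
  match l with
  | context [cons a _] => l
  | _ => constr:(cons a l)
  end.

Ltac mcollect l t :=
  lazymatch t with
  | GRing.add ?a ?b => let l := mcollect l a in mcollect l b
  | GRing.opp ?a => mcollect l a
  | GRing.scale _ ?a => mcollect l a
  | GRing.zero => l
  | _ => madd_atom l t
  end.

Ltac mindex l a :=
  lazymatch l with
  | cons a _ => constr:(O)
  | cons _ ?l' => let n := mindex l' a in constr:(S n)
  end.

Ltac mreify K l t :=
  lazymatch t with
  | GRing.add ?a ?b =>
      let a := mreify K l a in let b := mreify K l b in constr:(@MAdd K a b)
  | GRing.opp ?a => let a := mreify K l a in constr:(@MOpp K a)
  | GRing.scale ?c ?a => let a := mreify K l a in constr:(@MScale K c a)
  | GRing.zero => constr:(@MZero K)
  | _ => let n := mindex l t in constr:(@MVar K n)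
  end.

(* Equalities between linear combinations: compares the coefficients of each
   vector that is not itself a sum, an opposite or a multiple, and leaves those
   that [ring] cannot identify. *)
Ltac module_over K V :=
  lazymatch goal with
  | |- ?t1 = ?t2 =>
      let l := mcollect (@nil V) t1 in
      let l := mcollect l t2 in
      let e1 := mreify K l t1 in
      let e2 := mreify K l t2 in
      change (@meval K V l e1 = @meval K V l e2);
      apply: mevalP; [by [] | cbn [mcoef_eq mcoef size eqn]; repeat split; try ring]
  end.

(** * Finite spans *)

Section FiniteSpans.
Variables (K : fieldType) (A : lmodType K).
Implicit Types (W X : set A).

Lemma subspaceP W :
  subspace W <-> W 0 /\ forall c u v, W u -> W v -> W (c *: u + v).
Proof.
split=> [[W0 Wl]|[W0 Wl]]; split.
- by move: W0; rewrite in_setE.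
- move=> c u v Wu Wv; by have := Wl c u v; rewrite !inE; apply.
- by rewrite inE.
- by move=> c u v; rewrite !inE; exact: Wl.
Qed.

Lemma subspaceZ W c u : subspace W -> W u -> W (c *: u).
Proof. by move=> /subspaceP[W0 Wl] Wu; rewrite -[_ *: _]addr0; exact: Wl. Qed.

Lemma subspaceD W u v : subspace W -> W u -> W v -> W (u + v).
Proof. by move=> /subspaceP[W0 Wl] Wu Wv; rewrite -[u]scale1r; exact: Wl. Qed.

Lemma subspace_sum W (I : Type) (s : seq I) (P : pred I) (f : I -> A) :
  subspace W -> (forall i, W (f i)) -> W (\sum_(i <- s | P i) f i).
Proof.
move=> sW Wf; apply: big_ind => //; first by have /subspaceP[] := sW.
by move=> u v; exact: subspaceD.
Qed.

Lemma lspan_subspace X : subspace (lspan X).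
Proof.
apply/subspaceP; split=> [W [/subspaceP[]]//|c u v Xu Xv W [sW XW]].
have /subspaceP[_ Wl] := sW; apply: Wl; [exact: Xu | exact: Xv].
Qed.

Lemma lspanP X W : subspace W -> X `<=` W -> lspan X `<=` W.
Proof. exact: smallest_sub. Qed.

Lemma lspan1 (a y : A) : lspan [set a] y <-> exists c, y = c *: a.
Proof.
split; last first.
  by move=> [c ->]; apply: subspaceZ (lspan_subspace _) _; exact: sub_gen_smallest.
apply: (@lspanP _ [set y | exists c, y = c *: a]); last first.
  by move=> _ ->; exists 1; rewrite scale1r.
apply/subspaceP; split; first by exists 0; rewrite scale0r.
by move=> c _ _ [k ->] [l ->]; exists (c * k + l); rewrite scalerDl scalerA.
Qed.

Lemma lspan_ordP n (b : 'I_n -> A) y :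
  lspan (range b) y <-> exists c : 'I_n -> K, y = \sum_i c i *: b i.
Proof.
split; last first.
  move=> [c ->]; apply: subspace_sum (lspan_subspace _) _ => i.
  by apply: subspaceZ (lspan_subspace _) _; apply: sub_gen_smallest; exists i.
apply: (@lspanP _ [set y | exists c : 'I_n -> K, y = \sum_i c i *: b i]).
  apply/subspaceP; split.
    by exists (fun=> 0); rewrite big1 // => i _; rewrite scale0r.
  move=> k _ _ [c ->] [d ->]; exists (fun i => k * c i + d i).
  rewrite scaler_sumr -big_split; apply: eq_bigr => i _.
  by rewrite scalerDl scalerA.
move=> _ [i _ <-]; exists (fun j => (j == i)%:R).
rewrite (bigD1 i) //= eqxx scale1r big1 ?addr0 //.
by move=> j /negPf ->; rewrite scale0r.
Qed.

Lemma lin_indep_ordP n (b : 'I_n -> A) :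
  lin_indep b <->
  forall c : 'I_n -> K, \sum_i c i *: b i = 0 -> forall i, c i = 0.
Proof.
split=> [bf c c0 i|bf s c us c0 i si].
  by apply: (bf (index_enum 'I_n) c) => //; rewrite ?index_enum_uniq ?mem_index_enum.
have /(_ _ i) := bf (fun i => if i \in s then c i else 0); rewrite si; apply.
apply: etrans c0; symmetry; rewrite big_uniq //= big_mkcond /=.
by apply: eq_bigr => j _; case: ifP; rewrite ?scale0r.
Qed.

(** If n < m, the m by n matrix of coordinates of the [c i] in terms of [b] has a nonzero row vector
    in its left kernel, and this is a dependence among the [c i]. *)
Lemma lin_indep_leq n m (b : 'I_n -> A) (c : 'I_m -> A) :
  lin_indep c -> (forall i, lspan (range b) (c i)) -> (m <= n)%N.
Proof.
move=> /lin_indep_ordP cf cb; rewrite leqNgt; apply/negP => ltnm.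
have /choice[M cM] i : exists d : 'I_n -> K, c i = \sum_j d j *: b j.
  by apply/lspan_ordP.
pose N := \matrix_(i, j) M i j.
have : kermx N != 0.
  rewrite -mxrank_eq0 mxrank_ker subn_eq0 -ltnNge.
  exact: leq_ltn_trans (rank_leq_col _) ltnm.
case/rowV0Pn => v /sub_kermxP vN0 /eqP; apply; apply/rowP => i.
rewrite mxE; apply: (cf (fun i => v 0 i)); rewrite /=.
under eq_bigr => k _ do rewrite cM scaler_sumr.
rewrite exchange_big big1 // => j _ /=.
under eq_bigr => k _ do rewrite scalerA.
rewrite -scaler_suml; have /rowP/(_ j) := vN0; rewrite !mxE => vNj.
rewrite (eq_bigr (fun k => v 0 k * N k j)) ?vNj ?scale0r // => k _.
by rewrite mxE.
Qed.

Lemma has_dim_unique W n m : has_dim W n -> has_dim W m -> n = m.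
Proof.
move=> [b [bf bW]] [c [cf cW]]; apply/eqP; rewrite eqn_leq.
rewrite (lin_indep_leq (b := c) bf) ?(lin_indep_leq (b := b) cf) //.
  by move=> i; rewrite bW -cW; apply: sub_gen_smallest; exists i.
by move=> i; rewrite cW -bW; apply: sub_gen_smallest; exists i.
Qed.

(** Induction on n: a dependent family keeps its span when a vector with nonzero coefficient in some
    relation is dropped. *)
Lemma has_dim_lspan_ord n (b : 'I_n -> A) : exists m, has_dim (lspan (range b)) m.
Proof.
elim: n b => [|n IHn] b.
  by exists 0%N, b; split=> //; apply/lin_indep_ordP => c _ [].
have [bf|/lin_indep_ordP/existsNP[c /not_implyP[c0 /existsNP[i /eqP ci]]]] :=
  pselect (lin_indep b); first by exists n.+1, b.
suff -> : lspan (range b) = lspan (range (b \o lift i)) by exact: IHn.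
apply/seteqP; split; apply: lspanP; try exact: lspan_subspace.
  move=> _ [j _ <-]; case: (unliftP i j) => [k ->|->].
    by apply: sub_gen_smallest; exists k.
  apply/lspan_ordP; exists (fun k => - (c i)^-1 * c (lift i k)).
  apply: (@scalerI _ _ (c i)) => //; move: c0; rewrite (bigD1_ord i) //=.
  move/eqP; rewrite addr_eq0 => /eqP ->; rewrite scaler_sumr -sumrN.
  by apply: eq_bigr => k _; rewrite scalerA mulrA mulrN divff // mulN1r scaleNr.
by move=> _ [j _ <-]; apply: sub_gen_smallest; exists (lift i j).
Qed.

End FiniteSpans.

(** In a nonzero J, an element of least size divides the others, since remainders stay in J. Applied
    to the annihilator of u_1 and to the union of a chain of ideals. *)
Lemma poly_ideal_principal (K : fieldType) (J : {poly K} -> Prop) :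
  J 0 -> (forall p q, J p -> J q -> J (p + q)) ->
  (forall p q, J q -> J (p * q)) -> exists g, forall p, J p <-> g %| p.
Proof.
move=> J0 JD JM.
have [[g [Jg g0]]|J00] := pselect (exists g, J g /\ g != 0); last first.
  exists 0 => p; rewrite dvd0p; split=> [Jp|/eqP -> //].
  by apply/negPn/negP => p0; apply: J00; exists p.
pose Q k := `[< exists g, [/\ J g, g != 0 & size g = k] >].
have exQ : exists k, Q k by exists (size g); apply/asboolP; exists g.
case: (ex_minnP exQ) => k /asboolP[h [Jh h0 <-]] hmin.
exists h => p; split=> [Jp|/dvdpP[q ->]]; last exact: JM.
apply/negPn/negP => nhp.
have : (size h <= size (p %% h)%R)%N.
  apply: hmin; apply/asboolP; exists (p %% h); split=> //.
  have -> : p %% h = p + (- (p %/ h)) * h by rewrite {2}(divp_eq p h); ring.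
  by apply: JD => //; apply: JM.
by rewrite leqNgt ltn_modp h0.
Qed.

(** * Peirce identities of a Bernstein algebra *)

Section PeirceIdentities.
Variables (K : fieldType) (A : lmodType K).
Variables (mul : {bilinear A -> A -> A}) (omega : {scalar A}) (e : A).
Hypotheses (K2 : (2%:R : K) != 0) (K3 : (3%:R : K) != 0).
Hypothesis mulC : forall y z, mul y z = mul z y.
Hypothesis omegaM : forall y z, omega (mul y z) = omega y * omega z.
Hypothesis bernstein :
  forall y, mul (mul y y) (mul y y) = omega y ^+ 2 *: mul y y.
Hypotheses (ee : mul e e = e) (we : omega e = 1).

Ltac module := module_over K A.

Lemma scale2_eq0 (a : A) : 2%:R *: a = 0 -> a = 0.
Proof. by move/eqP; rewrite scaler_eq0 (negPf K2) => /eqP. Qed.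

Lemma sqrD y z : mul (y + z) (y + z) = mul y y + 2%:R *: mul y z + mul z z.
Proof. rewrite !(linearDl, linearDr) /= (mulC z y); module. Qed.

Lemma quartic_coef_eq0 (c1 c2 c3 c4 : A) :
  (forall t : K, t *: c1 + t ^+ 2 *: c2 + t ^+ 3 *: c3 + t ^+ 4 *: c4 = 0) ->
  [/\ c1 = 0, c2 = 0, c3 = 0 & c4 = 0].
Proof.
move=> Pt; have := Pt 1; have := Pt (-1); have := Pt 2%:R; have := Pt (- 2%:R).
(* 24 is a common denominator for the inverse of the matrix of powers t, ..., t^4 at t = -2, 2, -1,
   1. *)
have K24 : (2 * (2 * (2 * 3)) : K) != 0 by rewrite !mulf_neq0.
set q1 := _ + _; set q2 := _ + _; set q3 := _ + _; set q4 := _ + _.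
move=> E1 E2 E3 E4.
have comb_eq0 (c : A) k1 k2 k3 k4 :
    (2 * (2 * (2 * 3))) *: c = k1 *: q1 + k2 *: q2 + k3 *: q3 + k4 *: q4 ->
    c = 0.
  rewrite E1 E2 E3 E4 !scaler0 !addr0 => /eqP.
  by rewrite scaler_eq0 (negPf K24) => /eqP.
split.
(* The coefficients are the rows of 24 times that inverse, with the values ordered t = -2, 2, -1,
   1. *)
- apply: (@comb_eq0 _ 2 (-2) (-16) 16); rewrite /q1 /q2 /q3 /q4; module.
- apply: (@comb_eq0 _ (-1) (-1) 16 16); rewrite /q1 /q2 /q3 /q4; module.
- apply: (@comb_eq0 _ (-2) 2 4 (-4)); rewrite /q1 /q2 /q3 /q4; module.
- apply: (@comb_eq0 _ 1 1 (-4) (-4)); rewrite /q1 /q2 /q3 /q4; module.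
Qed.

(* The four conclusions are the coefficients of t, ..., t^4 in
   ((e + t n)^2)^2 = (e + t n)^2. *)
Lemma peirce_coefs n : omega n = 0 ->
  let p := 2%:R *: mul e n in let q := mul n n in
  [/\ 2%:R *: mul e p = p, 2%:R *: mul e q + mul p p = q,
      mul p q = 0 & mul q q = 0].
Proof.
move=> wn p q.
have [t|c1 c2 c3 c4] := @quartic_coef_eq0 (2%:R *: mul e p - p)
    (2%:R *: mul e q + mul p p - q) (2%:R *: mul p q) (mul q q).
  have sq : mul (e + t *: n) (e + t *: n) = e + t *: p + t ^+ 2 *: q.
    rewrite sqrD ee linearZr_LR linearZl_LR linearZr_LR /= /p -/q; module.
  have := bernstein (e + t *: n).
  clearbody p q; have -> : omega (e + t *: n) = 1.
    by rewrite linearD linearZ /= we wn mulr0 addr0.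
  rewrite sq expr1n scale1r => /eqP.
  rewrite -subr_eq0 => /eqP Q; apply: etrans Q.
  rewrite !(linearDl, linearDr) /= !(linearZl_LR, linearZr_LR) /= ee.
  rewrite (mulC p e) (mulC q e) (mulC q p); module.
by split=> //; [exact: subr0_eq | exact: subr0_eq | exact: scale2_eq0].
Qed.

Definition isU u := 2%:R *: mul e u = u.
Definition isV v := mul e v = 0.

Lemma omegaU u : isU u -> omega u = 0.
Proof.
move=> /(congr1 omega); rewrite linearZ /= omegaM we mul1r => w2.
by move: (w2); rewrite mulr_natl mulr2n => /eqP; rewrite -subr_eq0 addrK => /eqP.
Qed.

Lemma omegaV v : isV v -> omega v = 0.
Proof. by move=> /(congr1 omega); rewrite omegaM we mul1r linear0. Qed.

Lemma isUD u u' : isU u -> isU u' -> isU (u + u').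
Proof. by rewrite /isU linearDr scalerDr => -> ->. Qed.

Lemma isUZ c u : isU u -> isU (c *: u).
Proof. by rewrite /isU linearZr_LR /= scalerA mulrC -scalerA => ->. Qed.

Lemma isVZ c v : isV v -> isV (c *: v).
Proof. by rewrite /isV linearZr_LR /= => ->; rewrite scaler0. Qed.

Lemma isU_isV_eq0 a : isU a -> isV a -> a = 0.
Proof. by move=> Ua Va; rewrite -Ua Va scaler0. Qed.

(** For n = u in [peirce_coefs], p = u and the second identity becomes 2 e q = 0. *)
Lemma mulUU u : isU u -> isV (mul u u).
Proof.
move=> Uu; have [_ + _ _] := peirce_coefs (omegaU Uu); rewrite Uu => /eqP.
by rewrite -subr_eq0 addrK => /eqP; exact: scale2_eq0.
Qed.

Lemma mulVV v : isV v -> isU (mul v v).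
Proof.
move=> Vv; have [_ + _ _] := peirce_coefs (omegaV Vv).
by rewrite Vv scaler0 linear0l addr0.
Qed.

Lemma peirce_coefsD u v : isU u -> isV v ->
  let q := mul u u + 2%:R *: mul u v + mul v v in
  [/\ 2%:R *: mul e q + mul u u = q, mul u q = 0 & mul q q = 0].
Proof.
move=> Uu Vv; have : omega (u + v) = 0.
  by rewrite linearD omegaU // omegaV // addr0.
move/peirce_coefs; rewrite /= sqrD.
by rewrite linearDr /= scalerDr Uu Vv scaler0 addr0 => -[].
Qed.

(** Removing the known u u and v v terms from 2 e q + u u = q leaves 2 e (2 u v) = 2 u v. *)
Lemma mulUV u v : isU u -> isV v -> isU (mul u v).
Proof.
move=> Uu Vv; have [+ _ _] := peirce_coefsD Uu Vv.
rewrite /isU !linearDr /= !scalerDr linearZr_LR /= mulUU // scaler0 add0r.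
rewrite (mulVV Vv) addrC addrA => /addIr /addrI; exact: scalerI.
Qed.

Lemma mulU_UV u v : isU u -> isV v -> mul u (mul u v) = 0.
Proof.
move=> Uu Vv; have [_ P1 _] := peirce_coefsD Uu Vv.
(* Replacing v by -v isolates the part odd in v: the two instances of u q = 0 differ by 4 u (u
   v). *)
have [_ P2 _] := peirce_coefsD Uu (isVZ (-1) Vv).
apply: scale2_eq0; apply: scale2_eq0; rewrite -[RHS]subr0 -{1}P1 -{1}P2.
rewrite !linearDr /= !(linearZr_LR, linearZl_LR) /=; module.
Qed.

Lemma mulU_UV_polar u u' v : isU u -> isU u' -> isV v ->
  mul u (mul u' v) + mul u' (mul u v) = 0.
Proof.
move=> Uu Uu' Vv; have := mulU_UV (isUD Uu Uu') Vv.
by rewrite !(linearDl, linearDr) /= !mulU_UV // add0r addr0 addrC.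
Qed.

(** When u u = 0, the instances of q q = 0 at v and at -v add up to 8 (u v)^2 + 2 (v v)^2, and (v
    v)^2 = 0 is the t^4 coefficient at n = v. *)
Lemma sqrUV_eq0 u v : isU u -> isV v -> mul u u = 0 ->
  mul (mul u v) (mul u v) = 0.
Proof.
move=> Uu Vv uu0; have [_ _ P1] := peirce_coefsD Uu Vv.
have [_ _ P2] := peirce_coefsD Uu (isVZ (-1) Vv).
have [_ _ _ P3] := peirce_coefs (omegaV Vv).
do 3 apply: scale2_eq0; transitivity (0 + 0 - 2%:R *: 0 : A); last by module.
rewrite -{1}P1 -{1}P2 -{1}P3 uu0 !(linearZr_LR, linearZl_LR) /= !add0r.
rewrite !(linearDl, linearDr) /= !(linearZl_LR, linearZr_LR) /=.
rewrite (mulC (mul v v) (mul u v)); module.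
Qed.

End PeirceIdentities.

(** * The cyclic module of an endomorphism *)

Section OrbitCombinations.
Variables (K : fieldType) (A : lmodType K) (L : {linear A -> A}) (u : A).

(* The vector p(L) u: the action of K[X] on u with X acting as L. *)
Definition orbit_comb (p : {poly K}) : A :=
  \sum_(i < size p) p`_i *: iter i L u.

Lemma orbit_comb_wide n (p : {poly K}) : (size p <= n)%N ->
  orbit_comb p = \sum_(i < n) p`_i *: iter i L u.
Proof.
move=> le_pn; rewrite /orbit_comb.
rewrite (big_ord_widen n (fun i => p`_i *: iter i L u)) //.
rewrite big_mkcond; apply: eq_bigr => i _.
by case: ltnP => // le_pi; rewrite nth_default ?scale0r.
Qed.

Fact orbit_comb_is_linear : linear orbit_comb.
Proof.
move=> c p q; pose n := maxn (size p) (size q).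
have le_cpq : (size (c *: p + q)%R <= n)%N.
  rewrite (leq_trans (size_polyD _ _)) // geq_max !leq_max.
  by rewrite size_scale_leq leqnn orbT.
rewrite (orbit_comb_wide le_cpq) (@orbit_comb_wide n p) ?leq_maxl //.
rewrite (@orbit_comb_wide n q) ?leq_maxr // scaler_sumr -big_split.
by apply: eq_bigr => i _; rewrite coefD coefZ scalerDl scalerA.
Qed.

HB.instance Definition _ :=
  GRing.isLinear.Build K {poly K} A *:%R orbit_comb orbit_comb_is_linear.

Lemma orbit_combD : {morph orbit_comb : p q / p + q}.
Proof. exact: linearD. Qed.

Lemma orbit_combN : {morph orbit_comb : p / - p}.
Proof. exact: linearN. Qed.

Lemma orbit_combZ c : {morph orbit_comb : p / c *: p}.
Proof. exact: linearZ. Qed.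

Lemma orbit_comb0 : orbit_comb 0 = 0.
Proof. exact: linear0. Qed.

Lemma orbit_combXn i : orbit_comb 'X^i = iter i L u.
Proof.
rewrite (@orbit_comb_wide i.+1) ?size_polyXn // (bigD1 ord_max) //=.
rewrite coefXn eqxx scale1r big1 ?addr0 // => j.
by rewrite -val_eqE /= coefXn => /negPf ->; rewrite scale0r.
Qed.

Lemma orbit_combMX p : orbit_comb ('X * p) = L (orbit_comb p).
Proof.
rewrite (@orbit_comb_wide (size p).+1).
  rewrite big_ord_recl coefXM scale0r add0r linear_sum.
  by apply: eq_bigr => i _; rewrite linearZ /= coefXM.
by rewrite mulrC (leq_trans (size_polyMleq _ _)) // size_polyX addn2.
Qed.

Lemma orbit_combXnM n p : orbit_comb ('X^n * p) = iter n L (orbit_comb p).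
Proof.
by elim: n => [|n IHn]; rewrite ?mul1r // exprS -mulrA orbit_combMX IHn.
Qed.

Lemma orbit_comb_subspace (W : set A) (p : {poly K}) : subspace W ->
  (forall i, (i < size p)%N -> W (iter i L u)) -> W (orbit_comb p).
Proof.
move=> sW Wi; rewrite /orbit_comb; apply: big_ind => [||i _].
- by have /subspaceP[] := sW.
- by move=> y z; exact: subspaceD.
- by apply: subspaceZ => //; exact: Wi.
Qed.

Lemma lspan_orbit : lspan (range (fun i => iter i L u)) = range orbit_comb.
Proof.
apply/seteqP; split.
  apply: lspanP => [|_ [i _ <-]]; last by exists 'X^i; rewrite ?orbit_combXn.
  apply/subspaceP; split; first by exists 0; rewrite ?linear0.
  by move=> c _ _ [p _ <-] [q _ <-]; exists (c *: p + q); rewrite ?linearP.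
move=> _ [p _ <-]; apply: orbit_comb_subspace (lspan_subspace _) _ => i _.
by apply: sub_gen_smallest; exists i.
Qed.

Lemma orbit_comb_annihilator :
  exists g, forall p, orbit_comb p = 0 <-> g %| p.
Proof.
apply: (@poly_ideal_principal _ (fun p => orbit_comb p = 0)).
- exact: linear0.
- by move=> p q p0 q0; rewrite linearD /= p0 q0 addr0.
- move=> p q q0; rewrite -[p]coefK poly_def mulr_suml linear_sum big1 // => i _.
  rewrite -scalerAl linearZ /= orbit_combXnM q0.
  rewrite (_ : iter i L 0 = 0) ?scaler0 //.
  by elim: (val i) => //= n ->; rewrite linear0.
Qed.

(** Independence reduces to [orbit_comb] having no kernel on the span of the chosen monomials. It
    covers both the whole orbit and its initial segments. *)
Lemma lin_indep_orbit (I : eqType) (f : I -> nat) : injective f ->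
  (forall (s : seq I) c, orbit_comb (\sum_(i <- s) c i *: 'X^(f i)) = 0 ->
     \sum_(i <- s) c i *: 'X^(f i) = 0 :> {poly K}) ->
  lin_indep (fun i => iter (f i) L u).
Proof.
move=> f_inj ker0 s c us c0 i si.
have /ker0/(congr1 (fun p : {poly K} => p`_(f i))) :
    orbit_comb (\sum_(j <- s) c j *: 'X^(f j)) = 0.
  rewrite linear_sum -[RHS]c0; apply: eq_bigr => j _.
  by rewrite linearZ /= orbit_combXn.
rewrite coef0 coef_sum (bigD1_seq i) //= coefZ coefXn eqxx mulr1.
rewrite big1 ?addr0 // => j; rewrite eq_sym => /negPf neq_ij.
by rewrite coefZ coefXn (inj_eq f_inj) neq_ij mulr0.
Qed.

End OrbitCombinations.

(** * The subalgebra generated by an element of weight 1 *)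

Local Arguments ppow : simpl never.

Section GeneratedSubalgebra.
Variables (K : fieldType) (A : lmodType K).
Variables (mul : {bilinear A -> A -> A}) (omega : {scalar A}) (x : A).
Hypotheses (K2 : (2%:R : K) != 0) (K3 : (3%:R : K) != 0).
Hypothesis mulC : forall y z, mul y z = mul z y.
Hypothesis omegaM : forall y z, omega (mul y z) = omega y * omega z.
Hypothesis bernstein :
  forall y, mul (mul y y) (mul y y) = omega y ^+ 2 *: mul y y.
Hypothesis wx : omega x = 1.

Local Notation e := (ppow mul x 2).
Local Notation u1 := (ppow mul x 3 - ppow mul x 2).
Local Notation v1 := (x + ppow mul x 2 - 2%:R *: ppow mul x 3).
Local Notation B := (alg mul x).
Local Notation U := (isU mul e).
Local Notation V := (isV mul e).
Local Notation phi := (orbit_comb (mul v1) u1).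

Ltac module := module_over K A.

Lemma sqr_idem : mul e e = e.
Proof. by rewrite bernstein wx expr1n scale1r. Qed.

Lemma omega_sqr : omega e = 1.
Proof. by rewrite omegaM wx mulr1. Qed.

Lemma omega_xe : omega (x - e) = 0.
Proof. by rewrite linearB /= wx omega_sqr subrr. Qed.

(** Here u_1 = e (x - e), so 2 u_1 is the element p of [peirce_coefs] at n = x - e. *)
Lemma U_u1 : U u1.
Proof.
have [E _ _ _] := peirce_coefs K2 K3 mulC bernstein sqr_idem omega_sqr omega_xe.
have u1E : u1 = mul e (x - e) by rewrite linearBr /= sqr_idem.
by rewrite u1E; apply: (scalerI K2); apply: etrans E; rewrite linearZr_LR.
Qed.

Lemma V_v1 : V v1.
Proof.
have := U_u1; rewrite /isU /isV !linearDr !linearNr !linearZr_LR /= sqr_idem.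
rewrite -[mul e x]/(ppow mul x 3) => /eqP; rewrite -subr_eq0 => /eqP E.
transitivity (- (0 : A)); last by rewrite oppr0.
by rewrite -E; module.
Qed.

Lemma x_peirce : x = e + 2%:R *: u1 + v1.
Proof. by module. Qed.

Lemma mulv1_U u : U u -> U (mul v1 u).
Proof.
move=> Uu; rewrite mulC.
exact: (mulUV K2 K3 mulC omegaM bernstein sqr_idem omega_sqr Uu V_v1).
Qed.

(** This is x x = e expanded along [x_peirce], grouped so that the first summand lies in V and the
    second in U. *)
Lemma sqr_x_peirce :
  2%:R *: (2%:R *: mul u1 u1) +
  (mul v1 v1 + 2%:R *: u1 + 2%:R *: (2%:R *: mul v1 u1)) = 0.
Proof.
have Eu := U_u1; have Ev := V_v1; have Ex := x_peirce.
have : mul x x = e by [].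
move: (ppow mul x 2) sqr_idem Eu Ev Ex => e0 ee0 Eu Ev Ex /eqP.
rewrite -subr_eq0 => /eqP <-.
move: (ppow mul x 3 - e0) (x + e0 - _ *: _) Eu Ev Ex => u v Eu Ev ->.
rewrite !sqrD // ee0 !(linearDl, linearDr) /= !(linearZl_LR, linearZr_LR) /=.
rewrite Ev Eu (mulC v u); module.
Qed.

(** By [sqr_x_peirce], 4 u_1 u_1 lies in U as well as in V, and these meet in 0. *)
Lemma sqr_u1 : mul u1 u1 = 0.
Proof.
do 2 apply: (scale2_eq0 K2).
apply: (@isU_isV_eq0 _ _ mul e); last first.
  do 2 apply: isVZ.
  exact: (mulUU K2 K3 mulC omegaM bernstein sqr_idem omega_sqr U_u1).
move/eqP: sqr_x_peirce; rewrite addr_eq0 => /eqP ->.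
rewrite -[X in isU _ _ X]scaleN1r.
apply: isUZ; apply: isUD; first apply: isUD.
- exact: (mulVV K2 K3 mulC omegaM bernstein sqr_idem omega_sqr V_v1).
- by apply: isUZ U_u1.
- by do 2 apply: isUZ; exact: mulv1_U U_u1.
Qed.

Lemma sqr_v1 : mul v1 v1 = - (2%:R *: u1) - 4%:R *: mul v1 u1.
Proof.
have := sqr_x_peirce; rewrite sqr_u1; move: (mul v1 v1) (mul v1 u1) u1 => a b c E.
by rewrite -[RHS]addr0 -E; module.
Qed.

Lemma U_iter i : U (iter i (mul v1) u1).
Proof. by elim: i => [|i IHi]; [exact: U_u1 | exact: mulv1_U]. Qed.

Lemma U_phi p : U (phi p).
Proof.
apply: orbit_comb_subspace => [|i _]; last exact: U_iter.
apply/subspaceP; split; first by rewrite /isU linear0r scaler0.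
by move=> c u v Uu Uv; apply: isUD => //; apply: isUZ.
Qed.

Lemma mule_phi p : mul e (phi p) = 2%:R^-1 *: phi p.
Proof. by rewrite -{2}(U_phi p) scalerA mulVf // scale1r. Qed.

Lemma omega_phi p : omega (phi p) = 0.
Proof. exact: (omegaU omegaM omega_sqr (U_phi p)). Qed.

(** Strong induction on the gap k between the two indices, with i arbitrary. Gap 0 is [sqrUV_eq0]
    iterated from u_1 u_1 = 0, and gap 1 is u (u v) = 0. *)
Lemma mul_iter_iter i j : mul (iter i (mul v1) u1) (iter j (mul v1) u1) = 0.
Proof.
wlog le_ij : i j / (i <= j)%N => [H|].
  by have [/H//|/ltnW/H] := leqP i j; rewrite mulC.
rewrite -(subnKC le_ij) addnC; move: (j - i)%N => k {j le_ij}.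
have [n] := ubnP k; elim: n k i => // n IHn [|[|k]] i lekn.
- elim: i {IHn} => [|i IHi]; first exact: sqr_u1.
  rewrite iterS (mulC v1).
  exact: (sqrUV_eq0 K2 K3 mulC omegaM bernstein sqr_idem omega_sqr
    (U_iter i) V_v1).
- rewrite iterS (mulC v1).
  exact: (mulU_UV K2 K3 mulC omegaM bernstein sqr_idem omega_sqr
    (U_iter i) V_v1).
(* Polarisation moves one factor v_1 from the right index to the left one, so a gap k + 2 becomes a
   gap k. *)
have := mulU_UV_polar K2 K3 mulC omegaM bernstein sqr_idem omega_sqr
    (U_iter i) (U_iter (k.+1 + i)) V_v1.
  have wk0 : mul (iter (k.+1 + i) (mul v1) u1) (iter i.+1 (mul v1) u1) = 0.
    by rewrite addSnnS mulC IHn // -ltnS ltnW.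
  by rewrite !(mulC _ v1) -[mul v1 (iter i _ _)]iterS wk0 addr0.
Qed.


Lemma mul_phi_phi p q : mul (phi p) (phi q) = 0.
Proof.
apply: (@orbit_comb_subspace _ _ _ _ [set y | mul y (phi q) = 0]) => [|i _].
  apply/subspaceP; split=> [|c u v /= u0 v0]; first exact: linear0l.
  by rewrite linearDl /= linearZl_LR u0 v0 scaler0 addr0.
apply: (@orbit_comb_subspace _ _ _ _ [set y | mul _ y = 0]) => [|j _].
  apply/subspaceP; split=> [|c u v /= u0 v0]; first exact: linear0r.
  by rewrite linearDr /= linearZr_LR /= u0 v0 scaler0 addr0.
exact: mul_iter_iter.
Qed.

Lemma phi1 : phi 1 = u1.
Proof. by rewrite -(expr0 'X) orbit_combXn. Qed.

Lemma mulv1_phi p : mul v1 (phi p) = phi ('X * p).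
Proof. by rewrite orbit_combMX. Qed.

Lemma sqr_v1_phi : mul v1 v1 = phi (- (2%:R *: 1) - 4%:R *: 'X).
Proof.
have := mulv1_phi 1; rewrite phi1 mulr1 => v1u1.
by rewrite orbit_combD !orbit_combN !orbit_combZ -v1u1 phi1 sqr_v1.
Qed.

(** * Coordinates on alg(x) and its multiplication table *)

Local Notation comb a b p := (a *: e + b *: v1 + phi p).

(** The v_1-coordinate of a product is always 0, so all powers of an element from the second on lie
    in Ke + U_x. *)
Lemma mul_comb a b p a' b' p' :
  mul (comb a b p) (comb a' b' p') =
  comb (a * a') 0 ((b * b') *: (- (2%:R *: 1) - 4%:R *: 'X)
                   + ((a / 2%:R) *: p' + b *: ('X * p'))
                   + ((a' / 2%:R) *: p + b' *: ('X * p))).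
Proof.
have := sqr_v1_phi; rewrite !(orbit_combD, orbit_combN, orbit_combZ) -!mulv1_phi.
move: (phi 1) (phi 'X) => w1 w2 vv.
have Pp := mule_phi p; have Pp' := mule_phi p'; have Pz := mul_phi_phi p p'.
move: (phi p) (phi p') Pp Pp' Pz => u u' Pu Pu' uu0.
have := sqr_idem; have := V_v1; rewrite /isV.
move: v1 vv => v vv; move: e Pu Pu' => f Pu Pu' fv ff.
rewrite !(linearDl, linearDr) /= !(linearZl_LR, linearZr_LR) /=.
rewrite vv uu0 ff fv (mulC v f) fv (mulC u f) (mulC u v) Pu Pu'.
by rewrite !(scaler0, addr0) !scalerA; module.
Qed.

Lemma x_comb : x = comb 1 1 (2%:R *: 1).
Proof. by rewrite orbit_combZ phi1 !scale1r addrAC -x_peirce. Qed.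

Lemma omega_comb a b p : omega (comb a b p) = a.
Proof.
rewrite 2!linearD 2!linearZ /= omega_sqr (omegaV omegaM omega_sqr V_v1) omega_phi.
by rewrite mulr0 mulr1 !addr0.
Qed.

Lemma mule_comb a b p : mul e (comb a b p) = a *: e + 2%:R^-1 *: phi p.
Proof.
rewrite 2!linearDr !linearZr_LR /= sqr_idem mule_phi.
by have /= -> := V_v1; rewrite scaler0 addr0.
Qed.

(** The weight reads off a, and multiplication by e then isolates [phi p]. The conclusion is b v_1 =
    0 and not b = 0 because v_1 may vanish. *)
Lemma comb_eq0 a b p : comb a b p = 0 -> [/\ a = 0, b *: v1 = 0 & phi p = 0].
Proof.
move=> E; have a0 : a = 0 by rewrite -(omega_comb a b p) E linear0.
have /eqP := mule_comb a b p; rewrite E linear0r a0 scale0r add0r eq_sym.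
rewrite scaler_eq0 invr_eq0 (negPf K2) => /eqP p0; split=> //.
by move: E; rewrite a0 p0 scale0r add0r addr0.
Qed.

Lemma alg_subalgebra : subalgebra mul B.
Proof.
split=> [|y z By Bz W W_P].
  apply/subspaceP; split=> [W [[/subspaceP[]]]//|c u v Bu Bv W W_P].
  have [[/subspaceP[_ Wl] _] _] := W_P.
  by apply: Wl; [exact: Bu | exact: Bv].
by have [[_ mW] _] := W_P; apply: mW; [exact: By | exact: Bz].
Qed.

Lemma alg_gen : B x.
Proof. by move=> W [_]; apply. Qed.

(** By [mul_comb] the combinations are closed under products, and they contain x; conversely e, v_1
    and the iterates of u_1 are built from x. *)
Lemma algE : B = [set y | exists a b p, y = comb a b p].
Proof.
apply/seteqP; split.
  apply: smallest_sub => [|_ ->]; last first.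
    by exists 1, 1, (2%:R *: 1); exact: x_comb.
  split.
    apply/subspaceP; split.
      by exists 0, 0, 0; rewrite orbit_comb0 !scale0r !addr0.
    move=> c _ _ [a [b [p ->]]] [a' [b' [p' ->]]].
    exists (c * a + a'), (c * b + b'), (c *: p + p'); rewrite orbit_combD orbit_combZ.
    move: (phi p) (phi p') v1 => u u' v; module.
  by move=> _ _ [a [b [p ->]]] [a' [b' [p' ->]]]; rewrite mul_comb; do 3 eexists.
have [sB mB] := alg_subalgebra; have Bx := alg_gen.
have Be : B e by exact: mB.
have B3 : B (ppow mul x 3) by exact: mB.
have BN y z : B y -> B z -> B (y - z).
  move=> By Bz; rewrite -scaleN1r.
  by apply: (subspaceD sB) => //; exact: (subspaceZ _ sB).
have Bv : B v1 by apply: BN; [exact: (subspaceD sB) | exact: (subspaceZ _ sB)].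
move=> _ [a [b [p ->]]]; apply: (subspaceD sB).
  by apply: (subspaceD sB); exact: (subspaceZ _ sB).
apply: orbit_comb_subspace => // i _.
by elim: i => [|i IHi]; [exact: BN | exact: mB].
Qed.

Lemma mul_pow_x p : mul (e + phi p) x - e = phi (1 + 2%:R^-1 *: p + 'X * p).
Proof.
have -> : mul (e + phi p) x = mul (comb 1 0 p) (comb 1 1 (2%:R *: 1)).
  by rewrite -x_comb scale1r scale0r addr0.
rewrite mul_comb !mul1r mul0r scale1r !scale0r add0r !addr0 addrC addKr.
by rewrite scalerA mulVf // !scale1r addrA.
Qed.

(** By [mul_pow_x], x^(k+3) - x^2 = phi(p_k) with p_0 = 1 and p_(k+1) = 1 + p_k / 2 + X p_k. Solving
    for X p_k shows that the span is stable under v_1, hence contains the whole orbit of u_1. *)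
Lemma span_ppowE :
  lspan (range (fun k : nat => ppow mul x k.+3 - ppow mul x 2)) = range phi.
Proof.
set W := lspan _; have sW : subspace W := lspan_subspace _.
have Wgen k : W (ppow mul x k.+3 - e) by apply: sub_gen_smallest; exists k.
have Epow k : exists p, ppow mul x k.+3 = e + phi p.
  elim: k => [|k [p Ep]]; first by exists 1; rewrite phi1 addrC subrK.
  exists (1 + 2%:R^-1 *: p + 'X * p).
  by rewrite -mul_pow_x -Ep addrC subrK.
apply/seteqP; split.
  apply: lspanP => [|_ [k _ <-]].
    rewrite -lspan_orbit; exact: lspan_subspace.
  by have [p ->] := Epow k; exists p => //; rewrite (addrC e) addrK.
have Wv1 : W `<=` [set y | W (mul v1 y)].
  apply: lspanP => [|_ [k _ <-]].
    apply/subspaceP; split; first by rewrite /= linear0r; have /subspaceP[] := sW.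
    by move=> c u v /= Wu Wv; rewrite linearPr /=; have /subspaceP[_] := sW; apply.
  have [p Ep] := Epow k; rewrite /= Ep (addrC e) addrK mulv1_phi.
  have := Wgen k.+1; rewrite -[ppow mul x k.+4]/(mul (ppow mul x k.+3) x) Ep mul_pow_x.
  move=> W1; have := Wgen k; rewrite Ep (addrC e) addrK => W2.
  have W0 : W (phi 1) by rewrite phi1; exact: Wgen 0.
  have -> : 'X * p = (1 + 2%:R^-1 *: p + 'X * p) + ((- 1) *: 1 + (- 2%:R^-1) *: p).
    by rewrite !scaleNr scale1r; ring.
  rewrite orbit_combD; apply: (subspaceD sW) => //.
  rewrite orbit_combD !orbit_combZ.
  by apply: (subspaceD sW) => //; exact: (subspaceZ _ sW).
move=> _ [p _ <-]; apply: orbit_comb_subspace => // i _.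
by elim: i => [|i IHi]; [exact: Wgen 0 | exact: Wv1].
Qed.


Lemma alg_comb a b p : B (comb a b p).
Proof. by rewrite algE; exists a, b, p. Qed.

Lemma alg_phi p : B (phi p).
Proof. by have := alg_comb 0 0 p; rewrite !scale0r !add0r. Qed.

(** * Peirce decomposition of alg(x) *)

Lemma bernstein_alg : bernstein_algebra mul omega B.
Proof.
split=> [|y _]; last exact: bernstein.
split=> [|y z _ _|y z _ _|]; [exact: alg_subalgebra | exact: mulC | exact: omegaM |].
by exists x; [exact: alg_gen | rewrite wx oner_neq0].
Qed.

Lemma peirce_alg :
  peirce_decomposition mul omega B e (range phi) (lspan [set v1]).
Proof.
split; [|exact: sqr_idem|exact: omega_sqr|split|].
- by have := alg_comb 1 0 0; rewrite scale1r scale0r orbit_comb0 !addr0.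
- apply/seteqP; split=> [_ [p _ <-]|y []]; first split.
  + exact: alg_phi.
  + exact: U_phi.
  rewrite algE => -[a [b [p ->]]]; rewrite mule_comb => E.
  (* The equation 2 e y = y reads 2 a e + phi p = a e + b v_1 + phi p, that is, a e - b v_1 = 0. *)
  have /comb_eq0[a0 /eqP + _] : comb a (- b) 0 = 0.
    move: E; rewrite orbit_comb0 addr0 scalerDr !scalerA divff // scale1r.
    rewrite -[X in _ + X = _]add0r addrA.
    move=> /addIr /eqP; rewrite addr0 -subr_eq0 => /eqP <-.
    by move: v1 e => v f; module.
  rewrite scaleNr oppr_eq0 => /eqP bv0.
  by exists p => //; rewrite a0 bv0 scale0r !add0r.
- apply/seteqP; split=> [y /lspan1[b ->]|y []].
    split; last by rewrite linearZr_LR /= V_v1 scaler0.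
    by have := alg_comb 0 b 0; rewrite scale0r add0r orbit_comb0 addr0.
  rewrite algE => -[a [b [p ->]]]; rewrite mule_comb => E.
  have /comb_eq0[-> _ p0] : comb a 0 (2%:R^-1 *: p) = 0.
    by rewrite scale0r addr0 orbit_combZ.
  apply/lspan1; exists b; move: p0; rewrite orbit_combZ => /eqP.
  rewrite scaler_eq0 invr_eq0 (negPf K2) => /eqP ->.
  by rewrite scale0r add0r addr0.
split.
  apply/seteqP; split=> [y|_ [_ [_ [_ [/lspan1[a ->] [p _ <-] /lspan1[b ->] ->]]]]].
    rewrite algE => -[a [b [p ->]]]; exists (a *: e), (phi p), (b *: v1).
    split; [by apply/lspan1; exists a | by exists p | by apply/lspan1; exists b |].
    by rewrite addrAC.
  by rewrite addrAC; exact: alg_comb.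
move=> _ _ _ /lspan1[a ->] [p _ <-] /lspan1[b ->]; rewrite addrAC.
by case/comb_eq0=> -> -> ->; rewrite scale0r.
Qed.

(** * Bases and dimension *)

Local Notation w i := (iter i (mul v1) u1).

Lemma orbit_comb_sum (I : Type) (s : seq I) (c : I -> K) (f : I -> nat) :
  phi (\sum_(i <- s) c i *: 'X^(f i)) = \sum_(i <- s) c i *: w (f i).
Proof.
rewrite linear_sum; apply: eq_bigr => i _.
by rewrite -orbit_combXn; exact: orbit_combZ.
Qed.

Lemma basis_phi_infinite : (forall p, phi p = 0 -> p = 0) ->
  basis (range phi) (fun i => w i).
Proof.
move=> phi_inj; split; last exact: lspan_orbit.
by apply: (@lin_indep_orbit _ _ _ _ nat id) => // s c; exact: phi_inj.
Qed.

(** A multiple of g of degree below m is 0, which gives independence; reduction modulo g gives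
    spanning. *)
Lemma basis_phi_finite g m : (forall p, phi p = 0 <-> g %| p) ->
  size g = m.+1 -> basis (range phi) (fun i : 'I_m => w i).
Proof.
move=> gP size_g; have g0 : g != 0 by rewrite -size_poly_gt0 size_g.
split.
  apply: (@lin_indep_orbit _ _ _ _ 'I_m (@nat_of_ord m)).
    exact: val_inj.
  move=> s c /gP g_dvd.
  apply/eqP/negPn/negP => /dvdp_leq/(_ g_dvd); rewrite size_g ltnNge => /negP; apply.
  rewrite (leq_trans (size_sum _ _ _)) //; apply/bigmax_leqP_seq => i _ _.
  by rewrite (leq_trans (size_scale_leq _ _)) // size_polyXn.
apply/seteqP; split.
  rewrite -lspan_orbit; apply: lspanP; first exact: lspan_subspace.
  by move=> _ [i _ <-]; apply: sub_gen_smallest; exists (val i).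
move=> _ [p _ <-]; have -> : phi p = phi (p %% g).
  rewrite {1}(divp_eq p g) orbit_combD (_ : phi (_ * _) = 0) ?add0r //.
  by apply/gP; exact: dvdp_mull.
have lt_pm : (size (p %% g)%R <= m)%N by rewrite -ltnS -size_g ltn_modp.
rewrite (orbit_comb_wide _ _ lt_pm); apply/lspan_ordP.
by exists (fun i => (p %% g)`_i).
Qed.

(** When the annihilator of u_1 has degree m, the first m + 2 terms are the candidate basis of
    alg(x). *)
Definition alg_vector (i : nat) : A :=
  match i with 0 => e | 1 => v1 | k.+2 => w k end.

Lemma alg_vector_sum m (c : 'I_m.+2 -> K) :
  \sum_i c i *: alg_vector i =
  comb (c ord0) (c (lift ord0 ord0))
       (\sum_(i < m) c (lift ord0 (lift ord0 i)) *: 'X^i).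
Proof. by rewrite 2!big_ord_recl orbit_comb_sum addrA. Qed.

Lemma alg_span g m : (forall p, phi p = 0 <-> g %| p) -> size g = m.+1 ->
  lspan (range (fun i : 'I_m.+2 => alg_vector i)) = B.
Proof.
move=> gP size_g; rewrite algE; apply/seteqP; split.
  by move=> y /lspan_ordP[c ->]; rewrite alg_vector_sum; do 3 eexists.
set W := lspan _; have sW : subspace W := lspan_subspace _.
have Wb i : (i < m.+2)%N -> W (alg_vector i).
  by move=> lti; apply: sub_gen_smallest; exists (Ordinal lti).
move=> _ [a [b [p ->]]]; apply: (subspaceD sW).
  apply: (subspaceD sW); apply: (subspaceZ _ sW); first exact: (Wb 0).
  exact: (Wb 1).
have [_ spanU] := basis_phi_finite gP size_g.
have : range phi (phi p) by exists p.
rewrite -spanU; apply: lspanP => // _ [i _ <-].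
by apply: (Wb i.+2); rewrite !ltnS.
Qed.

Lemma has_dim_alg g m : (forall p, phi p = 0 <-> g %| p) -> size g = m.+1 ->
  v1 != 0 -> has_dim B m.+2.
Proof.
move=> gP size_g v0; exists (fun i => alg_vector i).
split; last exact: (alg_span gP).
apply/lin_indep_ordP => c; rewrite alg_vector_sum => /comb_eq0[c0 /eqP c1].
rewrite orbit_comb_sum => /= E.
have [/lin_indep_ordP/(_ _ E) c2 _] := basis_phi_finite gP size_g.
move=> i; case: (unliftP ord0 i) => [j ->|-> //].
case: (unliftP ord0 j) => [k -> //|->].
by move: c1; rewrite scaler_eq0 (negPf v0) orbF => /eqP.
Qed.


(** * Train identities and nilpotency of v_1 on U_x *)

Lemma mul_phi_comb r a b p :
  mul (phi r) (comb a b p) = phi ((a / 2%:R) *: r + b *: ('X * r)).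
Proof.
have -> : phi r = comb 0 0 r by rewrite !scale0r !add0r.
by rewrite mul_comb !mul0r !scale0r !add0r.
Qed.

(** On weight 0 a train identity says that a fixed power vanishes. It is applied to y = v_1 + phi p,
    whose powers are given by [powE]. *)
Lemma train_nilpotent : train_algebra mul omega B -> exists n, phi 'X^n = 0.
Proof.
move=> [_ [[|[|r]] [gamma [//= _ trainB]]]]; exists r.+1.
have nil0 y : B y -> omega y = 0 -> ppow mul y r.+2 = 0.
  move=> By wy; have := trainB y By; rewrite big_nat_cond big1 ?addr0 //.
  by move=> [|i] // _; rewrite wy exprS mul0r mulr0 scale0r.
have powE p k : ppow mul (comb 0 1 p) k.+2 =
    phi ('X^k * (- (2%:R *: 1) - 4%:R *: 'X + ('X * p + 'X * p))).
  elim: k => [|k IHk].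
    rewrite mul1r -[LHS]/(mul (comb 0 1 p) (comb 0 1 p)) mul_comb.
    by rewrite !mul0r mulr1 !scale0r !scale1r !add0r addrA.
  rewrite -[LHS]/(mul (ppow mul (comb 0 1 p) k.+2) (comb 0 1 p)) IHk mul_phi_comb.
  by rewrite mul0r scale0r scale1r add0r mulrA -exprS.
have N0 p : phi ('X^r * (- (2%:R *: 1) - 4%:R *: 'X + ('X * p + 'X * p))) = 0.
  by rewrite -powE nil0 ?omega_comb //; exact: alg_comb.
(* The instances p = 1 and p = 0 differ by X^r (2 X), which leaves 2 phi(X^(r+1)) = 0. *)
apply: (scale2_eq0 K2); rewrite -orbit_combZ -[RHS]subr0 -{1}(N0 1) -(N0 0).
rewrite -orbit_combN -orbit_combD; congr (phi _).
by move: (- _ - _) => q; rewrite scaler_nat exprSr; ring.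
Qed.

(** The train polynomial is t^2 (t - 1) (t - 1/2)^n: y^3 - omega(y) y^2 lies in U_x, and each factor
    t - 1/2 then brings out one more X, as y acts on U_x by omega(y)/2 + b X. *)
Lemma nilpotent_train n : (forall p, phi ('X^n * p) = 0) ->
  train_algebra mul omega B.
Proof.
move=> nil; split; first by case: bernstein_alg.
have [gamma [gamma0 gammaP]] : exists gamma : nat -> K, gamma 0 = 1 /\
    forall a b p, exists q,
      \sum_(i < n.+3) (gamma i * a ^+ i) *: ppow mul (comb a b p) (n.+3 - i)
      = phi ('X^n * q).
  elim: n {nil} => [|k [gamma [gamma0 IHk]]].
    (* The coefficients of t^3 - t^2. The difference y^2 - a y would still have a v_1-component,
       hence the cubic start. *)
    exists (fun i => nth 0 [:: 1; -1] i); split=> // a b p.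
    set q2 := ((b * b) *: (- (2%:R *: 1) - 4%:R *: 'X)
       + ((a / 2%:R) *: p + b *: ('X * p)) + ((a / 2%:R) *: p + b *: ('X * p))).
    have E2 : ppow mul (comb a b p) 2 = comb (a * a) 0 q2 by exact: mul_comb.
    clearbody q2.
    have [q3 E3] : exists q, ppow mul (comb a b p) 3 = comb (a * a * a) 0 q.
      rewrite -[ppow _ _ _]/(mul (ppow mul (comb a b p) 2) (comb a b p)) E2 mul_comb.
      by rewrite mul0r; eexists.
    exists (q3 - a *: q2); rewrite !big_ord_recl big_ord0 /= E2 E3.
    have -> : 'X^0 * (q3 - a *: q2) = q3 - a *: q2 by rewrite mul1r.
    rewrite orbit_combD orbit_combN orbit_combZ /bump /= add1n expr1.
    move: (phi q2) (phi q3) v1 e (ppow _ _ _) => u2 u3 v f y; module.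
  pose g i := if (i < k.+3)%N then gamma i else 0.
  (* Coefficients of the product with t - 1/2; [g] is [gamma] extended by 0 at the new last
     index. *)
  exists (fun i => g i - (if i is j.+1 then gamma j / 2%:R else 0)).
  split=> [|a b p]; first by rewrite subr0.
  have [q Eq] := IHk a b p; exists (b *: q).
  transitivity (mul (phi ('X^k * q)) (comb a b p) - (a / 2%:R) *: phi ('X^k * q)).
    rewrite -Eq linear_sumlz /=.
    under eq_bigr => i _ do rewrite mulrBl scalerBl.
    rewrite sumrB big_ord_recr /= /g ltnn mul0r scale0r addr0.
    congr (_ - _).
      apply: eq_bigr => i _; rewrite linearZl_LR /= ltn_ord; congr (_ *: _).
      by rewrite subSn ?(ltnW (ltn_ord i)) // -(subnSK (ltn_ord i)).
    rewrite big_ord_recl mul0r scale0r add0r scaler_sumr; apply: eq_bigr => i _.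
    by rewrite scalerA; congr (_ *: _); rewrite /= /bump add1n exprS add0n; ring.
  rewrite mul_phi_comb orbit_combD -orbit_combZ addrC addKr.
  by congr (phi _); rewrite exprS -scalerAr mulrA.
exists n.+3, gamma; split=> // y; rewrite algE => -[a [b [p ->]]].
rewrite omega_comb; have [q] := gammaP a b p; rewrite nil => E.
by rewrite -[RHS]E big_ord_recl gamma0 mulr1 scale1r subn0 big_add1 big_mkord.
Qed.


(** * Ideals of alg(x) and chain conditions *)

(** With y the given element, e y - e (e y) is a quarter of [phi p]; the other two components follow
    by subtraction. *)
Lemma ideal_comb I a b p : ideal mul B I -> I (comb a b p) ->
  [/\ I (a *: e), I (b *: v1) & I (phi p)].
Proof.
move=> [sI _ mI] Iy; have Be : B e.
  by have := alg_comb 1 0 0; rewrite scale1r scale0r orbit_comb0 !addr0.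
have IN y z : I y -> I z -> I (y - z).
  move=> Iy' Iz; rewrite -scaleN1r.
  by apply: (subspaceD sI) => //; exact: (subspaceZ _ sI).
have Iey := mI _ _ Be Iy; have Ieey := mI _ _ Be Iey.
move: Iey Ieey; rewrite mule_comb linearDr !linearZr_LR /= sqr_idem mule_phi.
move=> Iey Ieey; have Ip : I (phi p).
  have /= := subspaceZ (2%:R * 2%:R) sI (IN _ _ Iey Ieey).
  by congr I; move: (phi p) e => u f; module; field.
have Ia : I (a *: e).
  by have := IN _ _ Iey (subspaceZ 2%:R^-1 sI Ip); rewrite addrK.
by split=> //; have := IN _ _ (IN _ _ Iy Ip) Ia; rewrite addrK (addrC (a *: e)) addrK.
Qed.

Lemma ideal_phiM I p q : ideal mul B I -> I (phi q) -> I (phi (p * q)).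
Proof.
move=> [sI _ mI] Iq; rewrite -[p]coefK poly_def mulr_suml linear_sum /=.
apply: (subspace_sum _ _ sI) => i; rewrite -scalerAl [X in I X]orbit_combZ.
apply: (subspaceZ _ sI); rewrite orbit_combXnM.
elim: (val i) => //= n; apply: mI.
by have := alg_comb 0 1 0; rewrite scale1r scale0r orbit_comb0 add0r addr0.
Qed.

Lemma alg_noetherian : noetherian mul B.
Proof.
move=> I idI subI.
have mono j k : (j <= k)%N -> I j `<=` I k.
  move=> /subnKC <-; elim: (k - j)%N => [|n IHn] y Iy; rewrite ?addn0 //.
  by rewrite addnS; apply/subI/IHn.
have sI k : subspace (I k) by case: (idI k).
(* Membership of a fixed vector is settled at some index; when no [I k] contains y, any index will
   do. *)
have stable (y : A) : exists N, forall k, I k y -> I N y.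
  have [[N INy]|noI] := pselect (exists k, I k y); first by exists N.
  by exists 0%N => k Iky; case: noI; exists k.
have [Ne eP] := stable e; have [Nv vP] := stable v1.
(* The polynomials whose image lies in some [I k] form an ideal of K[X]; the chain has stabilised on
   U_x once it contains the image of the generator. *)
have [g gP] : exists g, forall p, (exists k, I k (phi p)) <-> g %| p.
  apply: poly_ideal_principal => [|p q [j Ip] [k Iq]|p q [k Iq]].
  - by exists 0%N; rewrite orbit_comb0; have /subspaceP[] := sI 0%N.
  - exists (maxn j k); rewrite orbit_combD; apply: (subspaceD (sI _)).
      by apply: mono Ip; exact: leq_maxl.
    by apply: mono Iq; exact: leq_maxr.
  - by exists k; apply: ideal_phiM (idI k) Iq.
have [Ng Ig] : exists k, I k (phi g) by apply/gP.
exists (maxn Ne (maxn Nv Ng)) => k leNk; set N := maxn _ _ in leNk *.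
have [Ne_le Nv_le Ng_le] : [/\ Ne <= N, Nv <= N & Ng <= N]%N.
  by rewrite /N !leq_max !leqnn !orbT.
apply/seteqP; split; last exact: mono.
move=> y Iy; have [_ /(_ _ Iy) + _] := idI k; rewrite algE => -[a [b [p Ey]]].
move: Iy; rewrite Ey => /(ideal_comb (idI k))[Ia Ib Ip].
have INZ c z : (I k z -> I N z) -> I k (c *: z) -> I N (c *: z).
  have [-> _ _|c0 IkN Icz] := eqVneq c 0.
    by rewrite scale0r; have /subspaceP[] := sI N.
  apply: (subspaceZ _ (sI N)); apply: IkN.
  by have := subspaceZ c^-1 (sI k) Icz; rewrite scalerA mulVf // scale1r.
apply: (subspaceD (sI N)); first apply: (subspaceD (sI N)).
- by apply: INZ Ia => /eP; exact: mono.
- by apply: INZ Ib => /vP; exact: mono.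
have /dvdpP[q ->] : g %| p by apply/gP; exists k.
by apply: (ideal_phiM _ (idI N)); exact: mono Ig.
Qed.

(** If the chain X^k K[X] u_1 stopped at N, then X^N = X^(N+1) p for some p, which the coefficient
    of X^N contradicts. *)
Lemma alg_not_artinian : (forall p, phi p = 0 -> p = 0) -> ~ artinian mul B.
Proof.
move=> phi_inj; pose I k := [set y | exists p, y = phi ('X^k * p)].
move=> /(_ I)[k|k _ [p ->]|N /(_ N.+1 (leqnSn N)) IN].
- split=> [|_ [p ->]|y _ + [p ->]]; last 2 first.
  + exact: alg_phi.
  + rewrite algE => -[a [b [q ->]]]; rewrite mulC mul_phi_comb.
    exists ((a / 2%:R) *: p + b *: ('X * p)).
    by rewrite mulrDr -!scalerAr mulrCA.
  apply/subspaceP; split; first by exists 0; rewrite mulr0 orbit_comb0.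
  move=> c _ _ [p ->] [q ->]; exists (c *: p + q).
  by rewrite mulrDr -scalerAr orbit_combD orbit_combZ.
- by exists ('X * p); rewrite mulrA -exprSr.
have : I N (phi ('X^N * 1)) by exists 1.
rewrite -IN => -[p Ep].
have pN0 : phi ('X^N - 'X^(N.+1) * p) = 0.
  by rewrite orbit_combD orbit_combN -Ep mulr1 subrr.
have /(congr1 (fun q : {poly K} => q`_N)) := phi_inj _ pN0.
rewrite coefB coefXn coefXnM ltnSn eqxx subr0 coef0 => /eqP.
by rewrite oner_eq0.
Qed.

(** * Degree of x and the annihilator of u_1 *)

(** A nonzero annihilator would give a finite spanning family of alg(x), from which a basis can be
    extracted even if v_1 = 0. *)
Lemma not_algebraic_inj : ~ algebraic mul x -> forall p, phi p = 0 -> p = 0.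
Proof.
move=> nalg p p0; have [g gP] := orbit_comb_annihilator (mul v1) u1.
have [g0|g_neq0] := eqVneq g 0; first by move/gP: p0; rewrite g0 dvd0p => /eqP.
case: nalg; have : size g = (size g).-1.+1 by rewrite prednK // size_poly_gt0.
by move=> /(alg_span gP) => BE; rewrite /algebraic -BE; exact: has_dim_lspan_ord.
Qed.

Lemma degree_annihilator n : (4 <= n)%N -> has_dim B n ->
  exists2 g, g \is monic & size g = (n - 2).+1 /\ forall p, phi p = 0 <-> g %| p.
Proof.
move=> n4 dimB; have [h hP] := orbit_comb_annihilator (mul v1) u1.
have [b [bf bB]] := dimB.
(* Otherwise the first n + 1 orbit vectors would be independent in dimension n. *)
have h0 : h != 0.
  apply/eqP => h0.
  have phi_inj p : phi p = 0 -> p = 0 by move/hP; rewrite h0 dvd0p => /eqP.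
  have indw : lin_indep (fun i : 'I_n.+1 => w i).
    by apply: (@lin_indep_orbit _ _ _ _ 'I_n.+1 (@nat_of_ord _)) => [|s c];
      [exact: val_inj | exact: phi_inj].
  suff : (n.+1 <= n)%N by rewrite ltnn.
  apply: (lin_indep_leq (b := b) indw) => i.
  by rewrite bB -orbit_combXn; exact: alg_phi.
(* If v_1 = 0, the formula for v_1^2 gives u_1 = 0, so alg(x) = Ke has dimension at most 1. *)
have v0 : v1 != 0.
  apply/eqP => v0; suff : (n <= 1)%N by move/(leq_trans n4).
  have u0 : u1 = 0.
    apply: (scale2_eq0 K2); apply: oppr_inj; rewrite oppr0.
    by have := sqr_v1; rewrite v0 !linear0l scaler0 subr0.
  apply: (lin_indep_leq (b := fun _ : 'I_1 => e) bf) => i.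
  have : B (b i) by rewrite -bB; apply: sub_gen_smallest; exists i.
  rewrite algE => -[a [c [p ->]]]; apply/lspan_ordP; exists (fun=> a).
  have -> : phi p = 0.
    apply: (@orbit_comb_subspace _ _ _ _ [set y | y = 0]) => [|j _] /=.
      apply/subspaceP; split=> // k y z /= -> ->.
      by rewrite scaler0 addr0.
    by elim: j => [//|j IHj]; rewrite iterS IHj linear0r.
  by rewrite big_ord1 v0 scaler0 !addr0.
exists ((lead_coef h)^-1 *: h).
  by rewrite monicE lead_coefZ mulVf // lead_coef_eq0.
have lc0 : (lead_coef h)^-1 != 0 by rewrite invr_eq0 lead_coef_eq0.
split=> [|p]; last by rewrite dvdpZl.
rewrite size_scale //; have Sh : size h = (size h).-1.+1.
  by rewrite prednK // size_poly_gt0.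
have := has_dim_unique dimB (has_dim_alg hP Sh v0).
by move=> ->; rewrite subSS subSS subn0.
Qed.


Lemma train_algP g m : (forall p, phi p = 0 <-> g %| p) -> g \is monic ->
  size g = m.+1 -> train_algebra mul omega B <-> g = 'X^m.
Proof.
move=> gP g_monic size_g; split=> [/train_nilpotent[n /gP]|gX]; last first.
  by apply: (@nilpotent_train m) => p; apply/gP; rewrite gX; exact: dvdp_mulr.
(* A divisor of X^n is associate to a power of X - 0; being monic, g equals it. *)
rewrite -['X]subr0 -polyC0 => /dvdp_exp_XsubCP[k _]; rewrite polyC0 subr0.
rewrite eqp_monic ?monicXn // => /eqP gX; rewrite gX; congr ('X^_).
by move: size_g; rewrite gX size_polyXn => -[].
Qed.

End GeneratedSubalgebra.

(** * Assembly of (i), (ii) and (iii) *)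

Theorem theorem3p2 (K : fieldType) (A : lmodType K)
    (mul : {bilinear A -> A -> A}) (omega : {scalar A}) (x : A) :
  infinite_set [set: K] -> 2%N \notin [pchar K] -> 3%N \notin [pchar K] ->
  bernstein_algebra mul omega [set: A] -> omega x = 1 ->
  let e := ppow mul x 2 in
  let Ux := lspan (range (fun k : nat => ppow mul x k.+3 - ppow mul x 2)) in
  let v1 := x + ppow mul x 2 - 2%:R *: ppow mul x 3 in
  let Vx := lspan [set v1] in
  [/\ bernstein_algebra mul omega (alg mul x),
      (* (i) *)
      peirce_decomposition mul omega (alg mul x) e Ux Vx /\
      (forall u u', Ux u -> Ux u' -> mul u u' = 0),
      (* (ii): u_i and beta_i are u i and beta i for 1 <= i <= n - 2 *)
      forall n : nat, (4 <= n)%N -> algebraic_of_degree mul x n ->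
      exists (u : nat -> A) (beta : nat -> K),
        [/\ basis Ux (fun i : 'I_(n - 2) => u i.+1),
            u 1%N = ppow mul x 3 - ppow mul x 2,
            (forall i : nat, (1 <= i <= n - 3)%N -> mul v1 (u i) = u i.+1),
            mul v1 (u (n - 2)%N) = \sum_(1 <= i < n - 1) beta i *: u i
          & mul v1 v1 = - (2%:R *: u 1%N) - 4%:R *: u 2%N] /\
        (train_algebra mul omega (alg mul x) <->
         forall i : nat, (1 <= i <= n - 2)%N -> beta i = 0)
    & (* (iii): u_i is u i for i >= 1 *)
      ~ algebraic mul x ->
      (exists u : nat -> A,
        [/\ basis Ux (fun i : nat => u i.+1),
            u 1%N = ppow mul x 3 - ppow mul x 2,
            (forall i : nat, (1 <= i)%N -> mul v1 (u i) = u i.+1)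
          & mul v1 v1 = - (2%:R *: u 1%N) - 4%:R *: u 2%N]) /\
      noetherian mul (alg mul x) /\ ~ artinian mul (alg mul x)].
Proof.
move=> _ K2c K3c [[_ mulCT omegaMT _] bernT] wx e Ux v1 Vx.
have K2 : (2%:R : K) != 0 by move: K2c; rewrite inE.
have K3 : (3%:R : K) != 0 by move: K3c; rewrite inE.
have mulC y z : mul y z = mul z y by exact: mulCT.
have omegaM y z : omega (mul y z) = omega y * omega z by exact: omegaMT.
have bern y : mul (mul y y) (mul y y) = omega y ^+ 2 *: mul y y by exact: bernT.
have UxE : Ux = range (orbit_comb (mul v1) (ppow mul x 3 - ppow mul x 2)).
  exact: span_ppowE.
rewrite UxE; split.
- exact: bernstein_alg.
- split; first exact: peirce_alg.
  by move=> _ _ [p _ <-] [q _ <-]; exact: mul_phi_phi.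
(* Indices start at 1, so u_i carries i - 1 factors v_1, and the value at 0 is a dummy. *)
- move=> n n4 dimB; pose u i := iter i.-1 (mul v1) (ppow mul x 3 - ppow mul x 2).
  have [g g_monic [size_g gP]] :=
    degree_annihilator K2 K3 mulC omegaM bern wx n4 dimB.
  (* The relation g(X) u_1 = 0 with g monic, solved for its leading term, determines the beta_i. *)
  exists u, (fun i => - g`_i.-1).
  have g_lead : g`_(n - 2) = 1.
    by move/monicP: g_monic; rewrite lead_coefE size_g.
  split; last first.
    rewrite (train_algP K2 K3 mulC omegaM bern wx gP g_monic size_g).
    split=> [-> i /andP[i1 i2]|g0].
      rewrite coefXn ltn_eqF ?oppr0 //.
      by rewrite -ltnS prednK.
    apply/polyP => i; rewrite coefXn.
    (* Coefficients below n - 2 vanish by hypothesis, the one at n - 2 is 1, and beyond it the size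
       of g gives 0. *)
    have [lti|gti|->] := ltngtP i (n - 2); last exact: g_lead.
      by apply/eqP; rewrite -oppr_eq0; apply/eqP; exact: (g0 i.+1).
    by rewrite nth_default // size_g.
  split.
  + exact: (basis_phi_finite gP size_g).
  + by [].
  + by case=> // i _.
  + have : orbit_comb (mul v1) (ppow mul x 3 - ppow mul x 2) g = 0 by apply/gP.
    rewrite /orbit_comb size_g big_ord_recr /= g_lead scale1r addrC => /eqP.
    rewrite addr_eq0 => /eqP E.
    have n2 : (n - 2 = (n - 3).+1)%N by rewrite subnSK // (leq_trans _ n4).
    have n1 : (n - 1 = (n - 2).+1)%N by rewrite subnSK // (leq_trans _ n4).
    rewrite /u n1 big_add1 big_mkord [in LHS]n2 /= -iterS -n2 E -sumrN.
    by apply: eq_bigr => i _; rewrite scaleNr.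
  + exact: (sqr_v1 K2 K3 mulC omegaM bern wx).
- move=> nalg; have phi_inj := not_algebraic_inj K2 K3 mulC omegaM bern wx nalg.
  split; last first.
    split; first exact: alg_noetherian.
    exact: alg_not_artinian.
  exists (fun i => iter i.-1 (mul v1) (ppow mul x 3 - ppow mul x 2)).
  split=> //.
  + exact: basis_phi_infinite.
  + by case=> // i _.
  + exact: (sqr_v1 K2 K3 mulC omegaM bern wx).
Qed.
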